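(* For each $r\ge1$, $Dist(T_r)$ is a separable algebra. In fact, every $h_{a_1,\ldots,a_m}$ (with $0\le a_1,\ldots,a_m<q$) is a primitive idempotent, and together they form a complete orthogonal decomposition of unity in $Dist(T_r)$.
   Context: $K$ is a field of characteristic $p>0$, $m\ge1$, $q=p^r$. $T$ is the torus of diagonal matrices of size $m$, $x_i=e_{ii}$. $Dist(T)$ is the commutative $K$-algebra with basis $\prod_{i=1}^m\binom{x_i}{a_i}$ ($a_i\ge0$), with multiplication obtained by tensoring with $K$ the ring of integer-valued polynomials over $\mathbb{Z}$ in the $x_i$. $Dist(T_r)$, the distribution algebra of the $r$-th Frobenius kernel $T_r$ of $T$, is the subalgebra with basis $\prod_i\binom{x_i}{a_i}$, $0\le a_i<q$. For $0\le a<q$ put $X_{i,a}=\sum_{k=a}^{q-1}(-1)^{k-a}\binom{k}{a}\binom{x_i}{k}$, and $h_{a_1,\ldots,a_m}=\prod_{i=1}^mX_{i,a_i}$. *)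

(* Defs.v *)
From HB Require Import structures.
From mathcomp Require Import all_boot all_order all_algebra all_field finmap.
From mathcomp Require Import -(notations) mpoly.
From mathcomp Require Import monalg zify ring.

Set Implicit Arguments.
Unset Strict Implicit.
Unset Printing Implicit Defensive.

Import Order.TTheory GRing.Theory Num.Theory.
Local Open Scope ring_scope.

Lemma bin_trinom n a c : (a <= c)%N ->
  ('C(n, c) * 'C(c, a) = 'C(n, a) * 'C(n - a, c - a))%N.
Proof.
move=> ac; have [nc|cn] := ltnP n c.
  rewrite (bin_small nc); have [na|an] := ltnP n a; first by rewrite (bin_small na).
  by rewrite (@bin_small (n - a)) ?muln0 //; lia.
have h : (0 < a`! * (c - a)`! * (n - c)`!)%N by rewrite !muln_gt0 !fact_gt0.
apply/eqP; rewrite -(eqn_pmul2r h); apply/eqP.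
have e1 := bin_fact cn; have e2 := bin_fact ac.
have e3 := bin_fact (leq_trans ac cn).
have e4 : ('C(n - a, c - a) * ((c - a)`! * (n - c)`!) = (n - a)`!)%N.
  by rewrite -[(n - c)%N](_ : n - a - (c - a) = n - c)%N ?bin_fact //; lia.
transitivity (n`!)%N; first by rewrite -e1 -e2; ring.
by rewrite -e3 -e4; ring.
Qed.

Lemma bin_mul_expand (n a b : nat) :
  ('C(n, a) * 'C(n, b) =
   \sum_(j < a.+1) 'C(b + j, a) * 'C(a, j) * 'C(n, b + j))%N.
Proof.
have E (j : 'I_a.+1) : ('C(b + j, a) * 'C(a, j) * 'C(n, b + j) =
    'C(n, a) * ('C(a, j) * ((a <= b + j) * 'C(n - a, b + j - a))))%N.
  have [h|h] := leqP a (b + j)%N; last by rewrite (bin_small h) !muln0.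
  by have := bin_trinom n h; nia.
rewrite (eq_bigr _ (fun j _ => E j)) -big_distrr /=.
have [na|an] := ltnP n a; first by rewrite (bin_small na) !mul0n.
congr muln; rewrite -{1}(subnKC an) -(binomial.Vandermonde a (n - a) b).
pose F j := ('C(a, j) * ((j <= b) * 'C(n - a, b - j)))%N.
have -> : (\sum_(j < b.+1) 'C(a, j) * 'C(n - a, b - j) =
           \sum_(0 <= j < b.+1) F j)%N.
  rewrite big_mkord; apply: eq_bigr => j _.
  by rewrite /F -ltnS ltn_ord mul1n.
have -> : (\sum_(j < a.+1) 'C(a, j) * ((a <= b + j) * 'C(n - a, b + j - a)) =
           \sum_(0 <= j < a.+1) F j)%N.
  rewrite big_mkord (reindex_inj rev_ord_inj) /=; apply: eq_bigr => j _.
  have ja := ltn_ord j; rewrite /F subSS bin_sub -1?ltnS //.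
  by congr (_ * (_ * 'C(_, _)))%N; lia.
have L c d : (c = a \/ c = b) -> (\sum_(0 <= j < c.+1 + d) F j =
    \sum_(0 <= j < c.+1) F j)%N.
  move=> hc; elim: d => [|d IH]; first by rewrite addn0.
  rewrite addnS big_nat_recr //= IH /F.
  by case: hc => ->; [rewrite bin_small ?mul0n ?addn0 //|
     rewrite (_ : (_ <= b)%N = false) ?mul0n ?muln0 ?addn0 //]; lia.
by rewrite -(L b a (or_intror erefl)) -(L a b (or_introl erefl)) !addSn addnC.
Qed.
Section MultiBinomial.
Variable m : nat.
Implicit Types a b n : {ffun 'I_m -> nat}.

Definition mbin n a : nat := (\prod_i 'C(n i, a i))%N.

Definition midx_bound a : nat := (\max_i a i).+1.

Definition shift_idx a b (j : {ffun 'I_m -> 'I_(midx_bound a)}) :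
    {ffun 'I_m -> nat} := [ffun i => b i + j i]%N.

(* The structure constants of the product of two monomials in the binomials:
   C(x,a) C(x,b) = \sum_(j <= a) C(b+j,a) C(a,j) C(x,b+j) in each variable;
   the terms with j i > a i vanish. *)
Definition bmul_coef a b (j : {ffun 'I_m -> 'I_(midx_bound a)}) : nat :=
  (\prod_i ('C(b i + j i, a i) * 'C(a i, j i)))%N.

Lemma bin_mul_expand_wide (n a b N : nat) : (a < N)%N ->
  ('C(n, a) * 'C(n, b) =
   \sum_(j < N) 'C(b + j, a) * 'C(a, j) * 'C(n, b + j))%N.
Proof.
move=> aN; rewrite bin_mul_expand.
pose F j := ('C(b + j, a) * 'C(a, j) * 'C(n, b + j))%N.
rewrite -(big_mkord xpredT F) -[RHS](big_mkord xpredT F).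
rewrite [RHS](@big_cat_nat _ _ _ a.+1) //= [X in (_ + X)%N]big_nat_cond.
rewrite [X in (_ + X)%N]big1 ?addn0 // => j /andP[/andP[h _] _].
by rewrite /F (bin_small h) muln0.
Qed.

Lemma midx_boundP a i : (a i < midx_bound a)%N.
Proof. by rewrite ltnS (leq_bigmax i). Qed.

Lemma mbinM n a b :
  (mbin n a * mbin n b =
   \sum_(j : {ffun 'I_m -> 'I_(midx_bound a)})
      bmul_coef b j * mbin n (shift_idx b j))%N.
Proof.
rewrite /mbin -big_split /=.
rewrite (eq_bigr _ (fun i _ =>
  bin_mul_expand_wide (n i) (b i) (midx_boundP a i))).
rewrite bigA_distr_bigA /=; apply: eq_bigr => j _.
by rewrite big_split /=; congr muln; apply: eq_bigr => i _; rewrite ffunE.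
Qed.

Lemma mbin_id a : mbin a a = 1%N.
Proof. by rewrite /mbin big1 // => i _; rewrite binn. Qed.

Lemma mbin_eq0 n a i : (n i < a i)%N -> mbin n a = 0%N.
Proof. by move=> h; rewrite /mbin (bigD1 i) //= bin_small. Qed.

Lemma mbin0 n : mbin n [ffun=> 0%N] = 1%N.
Proof. by rewrite /mbin big1 // => i _; rewrite ffunE bin0. Qed.

End MultiBinomial.

(* Dist(T): the element with coefficients c_a stands for
   \sum_a c_a \prod_i C(x_i, a_i). The structure constants dist_basis_mul of
   its product are those of the ring of integer-valued polynomials in
   x_1, ..., x_m; see mpbinM and int_valuedP below. *)
Definition distT (K : fieldType) (m : nat) := {malg K[{ffun 'I_m -> nat}]}.

HB.instance Definition _ (K : fieldType) m := GRing.Lmodule.on (distT K m).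

Section DistT.
Variables (K : fieldType) (m : nat).
Implicit Types (a b n : {ffun 'I_m -> nat}) (x y z : distT K m).

Definition dist_basis a : distT K m := << 1 *g a >>.

Definition dist_one : distT K m := dist_basis [ffun=> 0%N].

Definition dist_basis_mul a b : distT K m :=
  \sum_(j : {ffun 'I_m -> 'I_(midx_bound a)})
     (bmul_coef b j)%:R *: dist_basis (shift_idx b j).

Definition dist_mul x y : distT K m :=
  \sum_(a <- msupp x) \sum_(b <- msupp y)
     (x@_a * y@_b) *: dist_basis_mul a b.

(* Evaluation at a point of nat^m; jointly injective, whence the ring axioms. *)
Definition dist_ev n x : K := mmap idfun (fun a => (mbin n a)%:R) x.

Lemma dist_evB n : additive (dist_ev n).
Proof. by move=> x y; exact: (raddfB (mmap idfun _)). Qed.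
HB.instance Definition _ n :=
  GRing.isZmodMorphism.Build (distT K m) K (dist_ev n) (dist_evB n).

Lemma dist_evZ n : scalable_for *%R (dist_ev n).
Proof.
move=> c x; rewrite /dist_ev (mmapEw (msuppZ_le _ _)) mmapE big_distrr /=.
by apply: eq_bigr => k _; rewrite mcoeffZ mulrA.
Qed.
HB.instance Definition _ n :=
  GRing.isScalable.Build K (distT K m) K *%R (dist_ev n) (dist_evZ n).

Lemma dist_ev_basis n a : dist_ev n (dist_basis a) = (mbin n a)%:R.
Proof. by rewrite /dist_ev mmapU /= mul1r. Qed.

Lemma dist_evE n x : dist_ev n x = \sum_(a <- msupp x) x@_a * (mbin n a)%:R.
Proof. by []. Qed.

Lemma dist_ev_mul n x y : dist_ev n (dist_mul x y) = dist_ev n x * dist_ev n y.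
Proof.
rewrite /dist_mul raddf_sum [in RHS]dist_evE mulr_suml.
apply: eq_bigr => a _; rewrite raddf_sum dist_evE mulr_sumr /=.
apply: eq_bigr => b _; rewrite linearZ /= mulrACA -natrM mbinM; congr (_ * _).
rewrite natr_sum raddf_sum /=; apply: eq_bigr => j _.
by rewrite linearZ /= dist_ev_basis natrM.
Qed.

Lemma dist_ev_inj x y : (forall n, dist_ev n x = dist_ev n y) -> x = y.
Proof.
move=> exy; apply/eqP; rewrite -subr_eq0; apply/eqP; set z := x - y.
have ez n : dist_ev n z = 0 by rewrite raddfB /= exy subrr.
apply/malgP => a; rewrite mcoeff0.
have [N] := ubnP (\sum_i a i)%N; elim: N a => // N IH a aN.
have [/mcoeff_outdom //|az] := boolP (a \notin msupp z); rewrite negbK in az.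
have := ez a; rewrite dist_evE (bigD1_seq a) ?fset_uniq //=.
rewrite mbin_id mulr1 big1_seq ?addr0 // => b /andP[ba _].
have [/existsP[i h]|/existsPn h] := boolP [exists i, a i < b i]%N.
  by rewrite (mbin_eq0 h) mulr0.
rewrite IH ?mul0r // -ltnS (leq_trans _ aN) // ltnS.
have le i : (b i <= a i)%N by rewrite leqNgt.
have [i hi] : exists i, (b i < a i)%N.
  apply/existsP; apply: contraNT ba => /existsPn h'; apply/eqP/ffunP => i.
  by apply/eqP; rewrite eqn_leq le leqNgt h'.
rewrite (bigD1 i) //= [X in (_ < X)%N](bigD1 i) //= -addSn leq_add //.
exact: leq_sum.
Qed.

Lemma dist_ev1 n : dist_ev n dist_one = 1.
Proof. by rewrite dist_ev_basis mbin0. Qed.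

Fact dist_mulA : associative dist_mul.
Proof. by move=> x y z; apply: dist_ev_inj => n; rewrite !dist_ev_mul mulrA. Qed.
Fact dist_mulC : commutative dist_mul.
Proof. by move=> x y; apply: dist_ev_inj => n; rewrite !dist_ev_mul mulrC. Qed.
Fact dist_mul1 : left_id dist_one dist_mul.
Proof. by move=> x; apply: dist_ev_inj => n; rewrite dist_ev_mul dist_ev1 mul1r. Qed.
Fact dist_mulDl : left_distributive dist_mul +%R.
Proof.
move=> x y z; apply: dist_ev_inj => n.
by rewrite raddfD /= !dist_ev_mul raddfD mulrDl.
Qed.
Fact dist_one_neq0 : dist_one != 0.
Proof.
apply/eqP => /(congr1 (dist_ev [ffun=> 0%N])).
by rewrite dist_ev1 raddf0; apply/eqP; rewrite oner_eq0.
Qed.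

HB.instance Definition _ := GRing.Zmodule_isComNzRing.Build (distT K m)
  dist_mulA dist_mulC dist_mul1 dist_mulDl dist_one_neq0.

Fact dist_scaleAl (c : K) x y : c *: (x * y) = (c *: x) * y.
Proof.
by apply: dist_ev_inj => n; rewrite linearZ /= !dist_ev_mul linearZ /= mulrA.
Qed.

HB.instance Definition _ :=
  GRing.Lmodule_isLalgebra.Build K (distT K m) dist_scaleAl.
HB.instance Definition _ := GRing.Lalgebra_isComAlgebra.Build K (distT K m).

Lemma dist_ev_is_monoid n : monoid_morphism (dist_ev n).
Proof. by split=> [|x y]; [exact: dist_ev1|exact: dist_ev_mul]. Qed.
HB.instance Definition _ n :=
  GRing.isMonoidMorphism.Build (distT K m) K (dist_ev n) (dist_ev_is_monoid n).

Lemma dist_basisM a b : dist_basis a * dist_basis b = dist_basis_mul a b.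
Proof.
apply: dist_ev_inj => n; rewrite rmorphM /= !dist_ev_basis -natrM mbinM.
rewrite natr_sum raddf_sum /=; apply: eq_bigr => j _.
by rewrite linearZ /= dist_ev_basis natrM.
Qed.

(* C(x_i, k) *)
Definition xbin (i : 'I_m) (k : nat) : distT K m :=
  dist_basis [ffun j => if j == i then k else 0%N].

Lemma dist_basisE a : dist_basis a = \prod_i xbin i (a i).
Proof.
apply: dist_ev_inj => n; rewrite rmorph_prod /= dist_ev_basis natr_prod.
apply: eq_bigr => i _; rewrite dist_ev_basis; congr (_%:R).
rewrite /mbin (bigD1 i) //= ffunE eqxx big1 ?muln1 // => j /negbTE ji.
by rewrite ffunE ji bin0.
Qed.

End DistT.

Section IntegerValued.
Variable m : nat.
Implicit Types a b n : {ffun 'I_m -> nat}.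

Definition pbin (A : comAlgType rat) (x : A) (k : nat) : A :=
  (k`!%:R)^-1 *: \prod_(j < k) (x - j%:R).

Lemma pbin_nat (n k : nat) : pbin (n%:R : rat^o) k = 'C(n, k)%:R.
Proof.
rewrite /pbin; apply: (@mulfI _ k`!%:R); first by rewrite pnatr_eq0 -lt0n fact_gt0.
rewrite -[_ *: _]/(_ * _) mulrA mulfV ?mul1r; last first.
  by rewrite pnatr_eq0 -lt0n fact_gt0.
rewrite -natrM mulnC bin_ffact ffact_prod natr_prod.
have [nk|kn] := ltnP n k.
  rewrite (bigD1 (Ordinal nk)) //= subrr mul0r.
  by rewrite (bigD1 (Ordinal nk)) //= subnn mul0r.
by apply: eq_bigr => j _; rewrite natrB // ltnW // (leq_trans _ kn).
Qed.

Lemma pbin_int (z : int) (k : nat) : pbin (z%:~R : rat^o) k \is a Num.int.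
Proof.
case: z => n; first by rewrite (pbin_nat n).
suff -> : pbin ((Negz n)%:~R : rat^o) k = (-1) ^+ k * pbin ((n + k)%:R : rat^o) k.
  by rewrite pbin_nat rpredM ?rpredX ?rpredN ?rpred1 ?natr_int.
rewrite /pbin -scalerAr; congr (_ *: _).
rewrite [in RHS](reindex_inj rev_ord_inj) /= -[X in (-1) ^+ X]card_ord -prodrN.
apply: eq_bigr => j _; rewrite NegzE mulrNz opprD /=.
by rewrite [in RHS]natrB // -natr1 natrD; ring.
Qed.

Lemma horner_algZ (A : comAlgType rat) (x : A) c (P : {poly rat}) :
  horner_alg x (c *: P) = c *: horner_alg x P.
Proof. by rewrite -mul_polyC rmorphM /= horner_algC mulr_algl. Qed.

Lemma pbin_horner_alg (A : comAlgType rat) (x : A) k :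
  pbin x k = horner_alg x (pbin 'X k).
Proof.
rewrite horner_algZ rmorph_prod; congr (_ *: _); apply: eq_bigr => j _.
by rewrite rmorphB rmorph_nat /= horner_algX.
Qed.

Lemma pbinM (A : comAlgType rat) (x : A) (a b N : nat) : (a < N)%N ->
  pbin x a * pbin x b =
  \sum_(j < N) ('C(b + j, a) * 'C(a, j))%:R *: pbin x (b + j).
Proof.
move=> aN.
rewrite (pbin_horner_alg x a) (pbin_horner_alg x b) -rmorphM.
under eq_bigr do rewrite pbin_horner_alg -horner_algZ.
rewrite -raddf_sum; congr (horner_alg x _).
have ev (n k : nat) : (pbin 'X k).[n%:R] = 'C(n, k)%:R :> rat.
  rewrite -pbin_nat /pbin hornerZ horner_prod; congr (_ * _).
  by apply: eq_bigr => j _; rewrite hornerD hornerN hornerX -polyC_natr hornerC.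
set P := (X in X = _); set Q := RHS.
have h (n : nat) : P.[n%:R] = Q.[n%:R].
  rewrite hornerM !ev -natrM (bin_mul_expand_wide _ _ aN) natr_sum horner_sum.
  by apply: eq_bigr => j _; rewrite hornerZ ev natrM.
apply/eqP; rewrite -subr_eq0; apply/eqP.
pose s := [seq (l%:R : rat) | l <- iota 0 (size (P - Q))].
apply: (roots_geq_poly_eq0 (rs := s)); last by rewrite size_map size_iota.
  by apply/allP => _ /mapP[n _ ->]; rewrite /root hornerD hornerN h subrr.
by rewrite map_inj_uniq ?iota_uniq // => i j /eqP; rewrite eqr_nat => /eqP.
Qed.

Local Notation Qx := (mpoly.mpoly m rat).

(* \prod_i C(x_i, a_i), with x_i the i-th variable of Q[x_1, ..., x_m] *)
Definition mpbin a : Qx :=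
  \prod_(i < m) pbin (mpoly.mpolyX rat (mpoly.mnm1 i) : Qx) (a i).

Lemma mpbinM a b : mpbin a * mpbin b =
  \sum_(j : {ffun 'I_m -> 'I_(midx_bound a)})
     (bmul_coef b j)%:R *: mpbin (shift_idx b j).
Proof.
rewrite /mpbin -big_split /=.
rewrite (eq_bigr _ (fun i _ => pbinM _ (b i) (midx_boundP a i))).
rewrite bigA_distr_bigA /=; apply: eq_bigr => j _.
rewrite scaler_prod /bmul_coef natr_prod; congr (_ *: _).
by apply: eq_bigr => i _; rewrite ffunE.
Qed.

Definition int_valued (P : Qx) : Prop :=
  forall v : 'I_m -> int, mpoly.meval (fun i => (v i)%:~R) P \is a Num.int.

Definition mpbin_sum (x : distT rat m) : Qx :=
  \sum_(a <- msupp x) x@_a *: mpbin a.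

Lemma mpbin_sumE (d : {fset {ffun 'I_m -> nat}}) (x : distT rat m) :
  (msupp x `<=` d)%fset -> mpbin_sum x = \sum_(a <- d) x@_a *: mpbin a.
Proof.
move=> xd; rewrite /mpbin_sum (big_fset_incl _ xd) //= => a _ /mcoeff_outdom ->.
by rewrite scale0r.
Qed.

Lemma mpbin_sum_linear : linear mpbin_sum.
Proof.
move=> c x y; pose d := (msupp (c *: x + y) `|` (msupp x `|` msupp y))%fset.
rewrite !(@mpbin_sumE d) ?fsubsetUl //; first last.
- by rewrite /d fsubsetU // fsubsetUl orbT.
- by rewrite /d fsubsetU // fsubsetUr orbT.
rewrite scaler_sumr -big_split; apply: eq_bigr => a _ /=.
by rewrite mcoeffD mcoeffZ scalerDl scalerA.
Qed.
HB.instance Definition _ :=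
  GRing.isLinear.Build rat (distT rat m) Qx _ mpbin_sum mpbin_sum_linear.

Lemma mpbin_sum_basis a : mpbin_sum (dist_basis rat a) = mpbin a.
Proof.
rewrite (mpbin_sumE msuppU_le) big_seq_fset1 mcoeffUU scale1r //.
Qed.

Lemma mpbin_sumM x y : mpbin_sum (x * y) = mpbin_sum x * mpbin_sum y.
Proof.
rewrite [x * y]/(dist_mul x y) /dist_mul raddf_sum [in RHS]/mpbin_sum mulr_suml.
apply: eq_bigr => a _; rewrite raddf_sum /= mulr_sumr.
apply: eq_bigr => b _; rewrite linearZ /= -scalerAl -scalerAr scalerA.
congr (_ *: _); rewrite mpbinM raddf_sum /=; apply: eq_bigr => j _.
by rewrite linearZ /= mpbin_sum_basis.
Qed.

Lemma mpbin0 : mpbin [ffun=> 0%N] = 1.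
Proof.
rewrite /mpbin big1 // => i _.
by rewrite ffunE /pbin big_ord0 fact0 invr1 scale1r.
Qed.

Lemma mpbin_sum_onto (P : Qx) : exists x : distT rat m, P = mpbin_sum x.
Proof.
have h1 : exists x, 1 = mpbin_sum x.
  by exists (dist_basis rat [ffun=> 0%N]); rewrite mpbin_sum_basis mpbin0.
have hM (Q R : Qx) : (exists x, Q = mpbin_sum x) -> (exists x, R = mpbin_sum x) ->
    exists x, Q * R = mpbin_sum x.
  by move=> [x ->] [y ->]; exists (x * y); rewrite mpbin_sumM.
rewrite [P]mpoly.mpolyE; elim/big_ind: _.
- by exists 0; rewrite raddf0.
- by move=> _ _ [x ->] [y ->]; exists (x + y); rewrite raddfD.
move=> k _; suff [x ->] : exists x, mpoly.mpolyX rat k = mpbin_sum x.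
  by exists (mpoly.mcoeff k P *: x); rewrite linearZ.
rewrite mpoly.mpolyXE_id; elim/big_ind: _ => // i _.
elim: (k i) => [|e IH]; first by rewrite expr0.
rewrite exprS; apply: hM => //.
exists (xbin rat i 1); rewrite mpbin_sum_basis /mpbin (bigD1 i) //= big1.
  rewrite mulr1 ffunE eqxx /pbin big_ord1 subr0 /=.
  by rewrite (_ : 1`! = 1%N) // invr1 scale1r.
move=> j /negbTE ji.
by rewrite ffunE ji /pbin big_ord0 fact0 invr1 scale1r.
Qed.

Lemma meval_mpbin (v : 'I_m -> rat) a :
  mpoly.meval v (mpbin a) = \prod_i pbin (v i : rat^o) (a i).
Proof.
rewrite rmorph_prod; apply: eq_bigr => i _.
rewrite /pbin /= mpoly.mevalZ rmorph_prod; congr (_ * _).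
by apply: eq_bigr => j _; rewrite rmorphB rmorph_nat /= mpoly.mevalXU.
Qed.

Lemma meval_mpbin_sum n (x : distT rat m) :
  mpoly.meval (fun i => (n i)%:R) (mpbin_sum x) = dist_ev n x.
Proof.
rewrite raddf_sum dist_evE; apply: eq_bigr => a _ /=.
rewrite mpoly.mevalZ meval_mpbin natr_prod; congr (_ * _).
by apply: eq_bigr => i _; rewrite pbin_nat.
Qed.

Lemma dist_ev_int (x : distT rat m) :
  (forall n, dist_ev n x \is a Num.int) -> forall a, x@_a \is a Num.int.
Proof.
move=> ex a; have [N] := ubnP (\sum_i a i)%N; elim: N a => // N IH a aN.
have [/mcoeff_outdom ->|az] := boolP (a \notin msupp x); first exact: rpred0.
rewrite negbK in az.
have := ex a; rewrite dist_evE (bigD1_seq a) ?fset_uniq //= mbin_id mulr1.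
rewrite rpredDr // big_seq_cond; apply: rpred_sum => b /andP[_ ba].
have [/existsP[i h]|/existsPn h] := boolP [exists i, a i < b i]%N.
  by rewrite (mbin_eq0 h) mulr0 rpred0.
rewrite rpredM ?natr_int // IH // -ltnS (leq_trans _ aN) // ltnS.
have le i : (b i <= a i)%N by rewrite leqNgt.
have [i hi] : exists i, (b i < a i)%N.
  apply/existsP; apply: contraNT ba => /existsPn h'; apply/eqP/ffunP => i.
  by apply/eqP; rewrite eqn_leq le leqNgt h'.
rewrite (bigD1 i) //= [X in (_ < X)%N](bigD1 i) //= -addSn leq_add //.
exact: leq_sum.
Qed.

(* The mpbin a form a Z-basis of the ring of integer-valued polynomials; by
   mpbinM the structure constants in this basis are the bmul_coef, so distT K m
   is the tensor product of K with that ring. *)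
Theorem int_valuedP (P : Qx) : int_valued P <->
  exists! c : {malg int[{ffun 'I_m -> nat}]},
    P = \sum_(a <- msupp c) (c@_a)%:~R *: mpbin a.
Proof.
split=> [hP|[c [-> _]] v]; last first.
  rewrite raddf_sum rpred_sum // => a _ /=.
  rewrite mpoly.mevalZ meval_mpbin rpredM ?intr_int // rpred_prod // => i _.
  exact: pbin_int.
have [x ex] := mpbin_sum_onto P.
have hx : forall a, x@_a \is a Num.int.
  apply: dist_ev_int => n; rewrite -meval_mpbin_sum -ex.
  exact: (hP (fun i => n i : int)).
pose c : {malg int[{ffun 'I_m -> nat}]} :=
  \sum_(a <- msupp x) << Num.floor x@_a *g a >>.
have cE a : (c@_a)%:~R = x@_a.
  rewrite /c raddf_sum /=.
  have [/[dup] az /mcoeff_outdom ->|az] := boolP (a \notin msupp x).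
    rewrite big1_seq // => b /andP[_ hb]; rewrite mcoeffU.
    by case: eqP hb az => // -> ->.
  rewrite negbK in az; rewrite (bigD1_seq a) ?fset_uniq //= mcoeffUU.
  rewrite big1 ?addr0 ?floorK // => b /negbTE ba.
  by rewrite mcoeffU ba.
have toQ (d : {malg int[{ffun 'I_m -> nat}]}) (y : distT rat m) :
    (forall a, (d@_a)%:~R = y@_a) ->
    \sum_(a <- msupp d) (d@_a)%:~R *: mpbin a = mpbin_sum y.
  move=> dy; have -> : msupp d = msupp y.
    by apply/fsetP => a; rewrite -!mcoeff_neq0 -dy intr_eq0.
  by apply: eq_bigr => a _; rewrite dy.
exists c; split; first by rewrite ex (toQ c x).
move=> d ed; apply/malgP => a.
pose y : distT rat m := \sum_(b <- msupp d) << (d@_b)%:~R *g b >>.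
have yE b : (d@_b)%:~R = y@_b.
  rewrite /y raddf_sum /=.
  have [/[dup] bz /mcoeff_outdom ->|bz] := boolP (b \notin msupp d).
    rewrite big1_seq // => e /andP[_ he]; rewrite mcoeffU.
    by case: eqP he bz => // -> ->.
  rewrite negbK in bz; rewrite (bigD1_seq b) ?fset_uniq //= mcoeffUU.
  by rewrite big1 ?addr0 // => e /negbTE eb; rewrite mcoeffU eb.
apply: (@intr_inj rat); rewrite cE yE.
suff -> : x = y by [].
by apply: dist_ev_inj => n; rewrite -!meval_mpbin_sum -ex ed (toQ d y).
Qed.

End IntegerValued.

Section DistTrPred.
Variables (K : fieldType) (m p : nat) (hp : p \in [pchar K]) (r : nat).

Lemma bin_pchar (k : nat) : (0 < k < p ^ r)%N -> 'C(p ^ r, k)%:R = 0 :> K.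
Proof.
move=> /andP[k0 kq]; have pp := pcharf_prime hp.
have hq : [pchar {poly K}].-nat (p ^ r)%N.
  rewrite pnatX; apply/orP; left; rewrite pnatE //.
  exact: (rmorph_pchar polyC).
have := exprDn_pchar 1 'X hq; rewrite exprDn => /(congr1 (fun P : {poly K} => P`_k)) /=.
rewrite coef_sum (bigD1 (Ordinal (ltnW kq : (k < (p ^ r).+1)%N))) //=.
rewrite !expr1n mul1r coefMn coefXn eqxx big1 ?addr0 => [->|i ik]; last first.
  rewrite expr1n mul1r coefMn coefXn; case: eqP => [ki|]; last by rewrite mul0rn.
  by case/eqP: ik; apply: val_inj.
by rewrite coefD coef1 coefXn -(prednK k0) /= prednK // (ltn_eqF kq) addr0.
Qed.

Lemma bin_addq_pchar (n k : nat) : (k < p ^ r)%N ->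
  'C(p ^ r + n, k)%:R = 'C(n, k)%:R :> K.
Proof.
move=> kq; rewrite -binomial.Vandermonde natr_sum big_ord_recl /=.
rewrite bin0 mul1n subn0 big1 ?addr0 // => i _; rewrite natrM bin_pchar ?mul0r //.
by rewrite /= (leq_trans _ kq) // ltnS ltn_ord.
Qed.

Definition in_box (a : {ffun 'I_m -> nat}) : bool := [forall i, a i < p ^ r]%N.

Definition distTr_pred of p \in [pchar K] : {pred distT K m} :=
  fun x => all in_box (msupp x).

Lemma distTr_predP x :
  reflect (forall a, ~~ in_box a -> x@_a = 0) (x \in distTr_pred hp).
Proof.
apply: (iffP allP) => h a.
  by apply: contraNeq; rewrite mcoeff_neq0 => /h.
by rewrite -mcoeff_neq0; apply: contraNT => /h ->.
Qed.

Fact distTr_submod : subsemimod_closed (distTr_pred hp).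
Proof.
split; first split.
- by apply/distTr_predP => a _; rewrite mcoeff0.
- move=> x y /distTr_predP hx /distTr_predP hy; apply/distTr_predP => a ha.
  by rewrite mcoeffD hx ?hy ?addr0.
- move=> c x /distTr_predP hx; apply/distTr_predP => a ha.
  by rewrite mcoeffZ hx ?mulr0.
Qed.
HB.instance Definition _ :=
  GRing.isSubmodClosed.Build K (distT K m) (distTr_pred hp) distTr_submod.

Lemma dist_basis_in a : in_box a -> dist_basis K a \in distTr_pred hp.
Proof.
move=> ha; apply/distTr_predP => b hb; rewrite mcoeffU.
by case: eqP hb ha => // ->  /negP.
Qed.

Fact distTr_semiring : semiring_closed (distTr_pred hp).
Proof.
split; first by split; [exact: rpred0 | exact: rpredD].
have box0 : in_box [ffun=> 0%N].
  by apply/forallP => i; rewrite ffunE expn_gt0 (prime_gt0 (pcharf_prime hp)).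
split; first exact: dist_basis_in.
move=> x y /allP hx /allP hy; rewrite [x * y]/(dist_mul x y).
rewrite /dist_mul big_seq rpred_sum // => a /hx /forallP ha.
rewrite big_seq rpred_sum // => b /hy /forallP hb.
rewrite rpredZ // rpred_sum // => j _.
have [hj|/forallPn[i hi]] := boolP (in_box (shift_idx b j)).
  by rewrite rpredZ // dist_basis_in.
rewrite ffunE -leqNgt in hi.
rewrite /bmul_coef natr_prod (bigD1 i) //= natrM.
suff -> : 'C(b i + j i, a i)%:R * 'C(a i, j i)%:R = 0 :> K.
  by rewrite mul0r scale0r rpred0.
have [h|h] := ltnP (a i) (j i); first by rewrite (bin_small h) mulr0.
rewrite -(subnKC hi) bin_addq_pchar ?ha // bin_small ?mul0r //.
by rewrite ltn_subLR // -addSn leq_add // hb.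
Qed.
HB.instance Definition _ :=
  GRing.isSemiringClosed.Build (distT K m) (distTr_pred hp) distTr_semiring.

End DistTrPred.

(* Dist(T_r), the subalgebra of Dist(T) spanned by the binomial monomials with
   all 0 <= a_i < p ^ r; it is closed under products because K has
   characteristic p, whence the argument hp. *)
Definition distTr (K : fieldType) (m p : nat) (hp : p \in [pchar K]) (r : nat) :=
  {x : distT K m | x \in distTr_pred r hp}.

Section DistTr.
Variables (K : fieldType) (m p : nat) (hp : p \in [pchar K]) (r : nat).
Local Notation A := (distTr m hp r).

HB.instance Definition _ := SubType.copy A {x : distT K m | x \in distTr_pred r hp}.
HB.instance Definition _ := [Choice of A by <:].
HB.instance Definition _ := [SubChoice_isSubZmodule of A by <:].
HB.instance Definition _ := [SubZmodule_isSubNzRing of A by <:].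
HB.instance Definition _ := [SubNzRing_isSubComNzRing of A by <:].
HB.instance Definition _ := [SubZmodule_isSubLmodule of A by <:].
HB.instance Definition _ := [SubNzRing_SubLmodule_isSubLalgebra of A by <:].
HB.instance Definition _ := GRing.Lalgebra_isComAlgebra.Build K A.

Definition box_idx (a : {ffun 'I_m -> 'I_(p ^ r)}) : {ffun 'I_m -> nat} :=
  [ffun i => a i : nat].

Definition distTr_v2r (x : A) : 'rV[K]_#|{ffun 'I_m -> 'I_(p ^ r)}| :=
  \row_k (val x)@_(box_idx (enum_val k)).

Fact distTr_vect_axiom : Vector.axiom #|{ffun 'I_m -> 'I_(p ^ r)}| A.
Proof.
exists distTr_v2r.
  by move=> c x y; apply/rowP => k; rewrite !mxE /= mcoeffD mcoeffZ.
have box_in a : in_box p r (box_idx a) by apply/forallP => i; rewrite ffunE.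
pose E (v : 'rV[K]_#|{ffun 'I_m -> 'I_(p ^ r)}|) : distT K m := \sum_k v 0 k *: dist_basis K (box_idx (enum_val k)).
have Ein v : E v \in distTr_pred r hp.
  by rewrite rpred_sum // => k _; rewrite rpredZ // dist_basis_in.
have Ecoef v k : (E v)@_(box_idx (enum_val k)) = v 0 k.
  rewrite /E raddf_sum (bigD1 k) //= mcoeffZ mcoeffUU mulr1 big1 ?addr0 // => l lk.
  rewrite mcoeffZ mcoeffU; case: eqP => [e|]; last by rewrite mulr0.
  case/eqP: lk; apply: enum_val_inj; apply/ffunP => i; apply: val_inj.
  by move/ffunP: e => /(_ i); rewrite !ffunE.
exists (fun v => Sub (E v) (Ein v) : A) => [x|v]; last first.
  by apply/rowP => k; rewrite mxE /= Ecoef.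
apply: val_inj; apply/malgP => a /=.
have [ha|ha] := boolP (in_box p r a); last first.
  have /distTr_predP -> // := Ein (distTr_v2r x).
  by have /distTr_predP -> := valP x.
pose a' : {ffun 'I_m -> 'I_(p ^ r)} := [ffun i => Ordinal (forallP ha i)].
have -> : a = box_idx (enum_val (enum_rank a')).
  by apply/ffunP => i; rewrite !ffunE enum_rankK ffunE.
by rewrite Ecoef mxE.
Qed.
HB.instance Definition _ := Lmodule_hasFinDim.Build K A distTr_vect_axiom.
HB.instance Definition _ := Algebra_isFalgebra.Build K A.

Lemma xbin_in (i : 'I_m) (k : 'I_(p ^ r)) : xbin K i k \in distTr_pred r hp.
Proof.
apply: dist_basis_in; apply/forallP => j; rewrite ffunE; case: eqP => // _.
by rewrite expn_gt0 (prime_gt0 (pcharf_prime hp)).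
Qed.

Definition distTr_xbin (i : 'I_m) (k : 'I_(p ^ r)) : A := Sub (xbin K i k) (xbin_in i k).

Definition distTr_X (i : 'I_m) (a : 'I_(p ^ r)) : A :=
  \sum_(k < p ^ r | (a <= k)%N)
     ((-1) ^+ (k - a) * 'C(k, a)%:R) *: distTr_xbin i k.

Definition distTr_h (a : {ffun 'I_m -> 'I_(p ^ r)}) : A := \prod_i distTr_X i (a i).

End DistTr.

Section TensorSquare.
Variables (K : fieldType) (A : vectType K).
Local Notation n := (\dim {:A}).
Local Notation e := (vbasis {:A}).

(* A (x) A for a finite-dimensional A: the entry t i j is the coefficient of
   e_i (x) e_j, for the basis e := vbasis {:A} of A. Lemmas tens_liftE and
   tens_lift_uniq are its universal property. *)
Definition tensor2 := 'M[K]_n.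

Definition tens (x y : A) : tensor2 := \matrix_(i, j) (coord e i x * coord e j y).

Definition tens_lift (V : lmodType K) (f : A -> A -> V) (t : tensor2) : V :=
  \sum_i \sum_j t i j *: f e`_i e`_j.

Lemma tens_lift_linear (V : lmodType K) (f : A -> A -> V) : linear (tens_lift f).
Proof.
move=> c s t; rewrite /tens_lift scaler_sumr -big_split; apply: eq_bigr => i _.
rewrite /= scaler_sumr -big_split; apply: eq_bigr => j _.
by rewrite !mxE scalerDl scalerA.
Qed.

Lemma tens_liftE (V : lmodType K) (f : A -> A -> V) :
    (forall y, linear (f^~ y)) -> (forall x, linear (f x)) ->
  forall x y, tens_lift f (tens x y) = f x y.
Proof.
move=> fl fr x y.
pose F y := GRing.isLinear.Build K A V _ (f^~ y) (fl y).
pose G x := GRing.isLinear.Build K A V _ (f x) (fr x).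
pose fy : {linear A -> V} := HB.pack (f^~ y) (F y).
rewrite -[RHS]/(fy x) {2}(coord_vbasis (memvf x)) linear_sum.
apply: eq_bigr => i _; rewrite linearZ /=.
pose fi : {linear A -> V} := HB.pack (f e`_i) (G e`_i).
rewrite -[f _ y]/(fi y) {2}(coord_vbasis (memvf y)) linear_sum scaler_sumr.
by apply: eq_bigr => j _; rewrite linearZ /= scalerA mxE.
Qed.

Lemma tens_lift_uniq (V : lmodType K) (f : A -> A -> V) (g : tensor2 -> V) :
  linear g -> (forall x y, g (tens x y) = f x y) -> g =1 tens_lift f.
Proof.
move=> gl gf t; pose G := GRing.isLinear.Build K tensor2 V _ g gl.
pose g' : {linear tensor2 -> V} := HB.pack g G.
rewrite -[LHS]/(g' t) {1}[t]matrix_sum_delta linear_sum; apply: eq_bigr => i _.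
rewrite linear_sum; apply: eq_bigr => j _; rewrite linearZ /=; congr (_ *: _).
rewrite -gf; congr g; apply/matrixP => k l; rewrite !mxE.
have fr : free e := basis_free (vbasisP {:A}).
by rewrite !(coord_free _ _ fr) -natrM mulnb ![_ == k]eq_sym ![_ == l]eq_sym.
Qed.

End TensorSquare.

Section Separable.
Variables (K : fieldType) (A : falgType K).

Definition tens_mul (t : tensor2 A) : A := tens_lift (fun x y => x * y) t.

Definition tens_actl (a : A) (t : tensor2 A) : tensor2 A :=
  tens_lift (fun x y => tens (a * x) y) t.

Definition tens_actr (t : tensor2 A) (b : A) : tensor2 A :=
  tens_lift (fun x y => tens x (y * b)) t.

(* The multiplication A (x) A -> A splits as a map of A-A-bimodules. *)
Definition separable_algebra : Prop :=
  exists s : A -> tensor2 A,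
    [/\ linear s,
        (forall x, tens_mul (s x) = x),
        (forall a x, s (a * x) = tens_actl a (s x)) &
        (forall x b, s (x * b) = tens_actr (s x) b)].

End Separable.

Definition idempotent_elt (A : pzRingType) (e : A) : Prop := e * e = e.

Definition primitive_idempotent (A : pzRingType) (e : A) : Prop :=
  [/\ e != 0, idempotent_elt e &
      forall f g : A, idempotent_elt f -> idempotent_elt g ->
        f * g = 0 -> g * f = 0 -> e = f + g -> f = 0 \/ g = 0].

Definition complete_orthogonal (A : pzRingType) (I : finType) (h : I -> A) : Prop :=
  [/\ forall i, idempotent_elt (h i),
      forall i j, i != j -> h i * h j = 0 &
      \sum_i h i = 1].

(* Main.v *)
From HB Require Import structures.
Require Import Defs.
From mathcomp Require Import all_boot all_order all_algebra all_field.

Set Implicit Arguments.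
Unset Strict Implicit.
Unset Printing Implicit Defensive.

Local Open Scope ring_scope.

Import GRing.Theory.

(** Up to isomorphism, [Dist(T_r)] is the algebra of all [K]-valued functions on
    the finite set [{0, ..., q - 1}^m], where [q = p ^ r], and the [h_a] are the
    indicator functions of its points.

    An element of [Dist(T)] is determined by its values at all the points of
    [nat^m]. In characteristic [p], Vandermonde's identity and the vanishing of
    [C(q, k)] for [0 < k < q] make [C(n, k)], for [k < q], depend only on [n]
    modulo [q], so an element of [Dist(T_r)] is already determined by its values
    at the points of [{0, ..., q - 1}^m] (lemma [distTr_ev_inj]).
    Evaluation at each of these points is a character of [Dist(T_r)], and
    binomial inversion says that [h_a] takes the value 1 at [a] and 0 at the
    other points (lemma [distTr_ev_h]).

    The three assertions are then formal: they hold in any algebra with a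
    finite, jointly injective family of characters [chi_i] and a dual family of
    elements [h_i]. In such an algebra [x * h_i = chi_i(x) h_i], so the corner
    [h_i A] is the line [K h_i], which makes [h_i] primitive, and
    [\sum_i h_i (x) h_i] is a separability idempotent (lemmas [split_primitive]
    and [split_separable]). *)

(** * Binomial coefficients *)

Lemma sum_sign_bin (R : comNzRingType) (N M : nat) : (N < M)%N ->
  \sum_(j < M) (-1) ^+ j * 'C(N, j)%:R = (N == 0%N)%:R :> R.
Proof.
move=> NM; pose F j : R := (-1) ^+ j * 'C(N, j)%:R.
rewrite -(big_mkord xpredT F) (@big_cat_nat _ _ _ N.+1) //=.
rewrite [X in _ + X]big_nat_cond [X in _ + X]big1 ?addr0; last first.
  by move=> j /andP[/andP[Nj _] _]; rewrite /F bin_small // mulr0.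
rewrite -expr0n -[X in X ^+ N](subrr 1) exprDn big_mkord; apply: eq_bigr => j _.
by rewrite /F expr1n mul1r mulr_natr.
Qed.

(** Binomial inversion. The trinomial identity
    [C(n, k) C(k, a) = C(n, a) C(n - a, k - a)] pulls [C(n, a)] out of the sum
    and leaves the expansion of [(1 - 1) ^ (n - a)]. *)
Lemma sum_sign_bin_bin (R : comNzRingType) (n a q : nat) : (n < q)%N ->
  \sum_(k < q | (a <= k)%N) (-1) ^+ (k - a) * 'C(k, a)%:R * 'C(n, k)%:R =
  (n == a)%:R :> R.
Proof.
move=> nq.
have E (k : 'I_q) : (a <= k)%N ->
    (-1) ^+ (k - a) * 'C(k, a)%:R * 'C(n, k)%:R =
    'C(n, a)%:R * ((-1) ^+ (k - a) * 'C(n - a, k - a)%:R) :> R.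
  move=> ak; rewrite -mulrA -natrM [('C(k, a) * _)%N]mulnC (bin_trinom n ak).
  by rewrite natrM mulrCA.
rewrite (eq_bigr _ E) -mulr_sumr.
have [na|an] := ltnP n a; first by rewrite bin_small // mul0r ltn_eqF.
pose F k : R := (-1) ^+ (k - a) * 'C(n - a, k - a)%:R.
have aq := leq_ltn_trans an nq.
rewrite -(big_mkord (fun k => a <= k)%N F) (@big_cat_nat _ _ _ a) //=; last exact: ltnW.
rewrite big_nat_cond big1 ?add0r; last first.
  by move=> k /andP[/andP[_ ka]]; rewrite leqNgt ka.
rewrite big_nat_cond (eq_bigl (fun k => (a <= k < q)%N)); last first.
  by move=> k /=; case: (a <= k)%N; rewrite ?andbT ?andbF.
rewrite -big_nat -[X in index_iota X](add0n a) big_addn big_mkord.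
rewrite (eq_bigr (fun j : 'I_(q - a) => (-1) ^+ j * 'C(n - a, j)%:R)); last first.
  by move=> j _; rewrite /F addnK.
rewrite sum_sign_bin ?ltn_sub2r //.
rewrite subn_eq0 eqn_leq an andbT.
have [na|] := leqP n a; last by rewrite mulr0.
have -> : n = a by apply/eqP; rewrite eqn_leq na.
by rewrite binn mulr1.
Qed.

Lemma bin_modq_pchar (K : fieldType) (p r n k : nat) : p \in [pchar K] ->
  (k < p ^ r)%N -> 'C(n, k)%:R = 'C(n %% p ^ r, k)%:R :> K.
Proof.
move=> hp kq; rewrite {1}(divn_eq n (p ^ r)).
elim: (n %/ p ^ r)%N => [|d IH]; first by rewrite mul0n add0n.
by rewrite mulSn -addnA (bin_addq_pchar hp).
Qed.

(** * Linearity in the tensor square *)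

Section TensorLinearity.
Variables (K : fieldType) (B : vectType K).

Lemma tens_linearl (y : B) : linear (fun x => tens x y).
Proof.
by move=> c x x'; apply/matrixP => i j; rewrite !mxE linearP /= mulrDl mulrA.
Qed.

Lemma tens_linearr (x : B) : linear (tens x).
Proof.
by move=> c y y'; apply/matrixP => i j; rewrite !mxE linearP /= mulrDr mulrCA.
Qed.

Lemma tens_lift_sum (I : finType) (V : lmodType K)
    (f : B -> B -> V) (c : I -> K) (t : I -> tensor2 B) :
  tens_lift f (\sum_i c i *: t i) = \sum_i c i *: tens_lift f (t i).
Proof.
pose F := GRing.isLinear.Build K _ V _ (tens_lift f) (tens_lift_linear f).
pose lift : {linear tensor2 B -> V} := HB.pack (tens_lift f) F.
rewrite -[LHS]/(lift _) linear_sum; apply: eq_bigr => i _.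
by rewrite linearZ.
Qed.

End TensorLinearity.

(** * Algebras split by characters *)

Section SplitByCharacters.
Variables (K : fieldType) (A : falgType K) (I : finType).
Variables (chi : I -> {lrmorphism A -> K | *%R}) (h : I -> A).
Hypothesis chi_inj : forall x y, (forall i, chi i x = chi i y) -> x = y.
Hypothesis chi_h : forall i j, chi i (h j) = (i == j)%:R.

Lemma mul_split_idem x i : x * h i = chi i x *: h i.
Proof.
apply: chi_inj => j; rewrite rmorphM linearZ /= chi_h.
by case: eqP => [->|_] //; rewrite !mulr0.
Qed.

Lemma split_mulC (x y : A) : x * y = y * x.
Proof. by apply: chi_inj => i; rewrite !rmorphM mulrC. Qed.

Lemma split_expand x : x = \sum_i chi i x *: h i.
Proof.
apply: chi_inj => j; rewrite linear_sum (bigD1 j) //= linearZ /= chi_h eqxx.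
rewrite mulr1 big1 ?addr0 // => i /negbTE ij.
by rewrite linearZ /= chi_h eq_sym ij mulr0.
Qed.

Lemma split_complete_orthogonal : complete_orthogonal h.
Proof.
split=> [i|i j ij|]; rewrite /idempotent_elt ?mul_split_idem ?chi_h.
- by rewrite eqxx scale1r.
- by rewrite eq_sym (negbTE ij) scale0r.
by rewrite [RHS]split_expand; apply: eq_bigr => i _; rewrite rmorph1 scale1r.
Qed.

(** A summand [f] of [h i = f + g] satisfies [f = f * h i], hence is a multiple
    of [h i]; two multiples of [h i] with product 0 cannot both be nonzero. *)
Lemma split_primitive i : primitive_idempotent (h i).
Proof.
have [idem _ _] := split_complete_orthogonal.
split=> // [|f g ff gg fg gf hE].
  by apply/eqP => /(congr1 (chi i)); rewrite chi_h eqxx raddf0; apply/eqP/oner_neq0.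
have fE : f = chi i f *: h i by rewrite -mul_split_idem hE mulrDr ff fg addr0.
have gE : g = chi i g *: h i by rewrite -mul_split_idem hE mulrDr gg gf add0r.
have /eqP : chi i f * chi i g = 0 by rewrite -rmorphM fg raddf0.
by rewrite mulf_eq0 => /orP[] /eqP c0; [left; rewrite fE|right; rewrite gE];
  rewrite c0 scale0r.
Qed.

(** The section sends [x] to [x . \sum_i h_i (x) h_i]; it is a bimodule map
    because [b] acts on [h_i (x) h_i] from either side as the scalar
    [chi i b]. *)
Lemma split_separable : separable_algebra A.
Proof.
exists (fun x => \sum_i chi i x *: tens (h i) (h i)); split.
- move=> c x y; rewrite scaler_sumr -big_split; apply: eq_bigr => i _ /=.
  by rewrite linearP scalerDl scalerA.
- have [idem _ _] := split_complete_orthogonal.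
  move=> x; rewrite /tens_mul tens_lift_sum [RHS]split_expand.
  apply: eq_bigr => i _; rewrite tens_liftE ?idem //.
    by move=> z c y y'; rewrite mulrDl -scalerAl.
  by move=> z c y y'; rewrite mulrDr -scalerAr.
- move=> b x; rewrite /tens_actl tens_lift_sum; apply: eq_bigr => i _.
  rewrite tens_liftE.
  + rewrite mul_split_idem rmorphM mulrC -scalerA; congr (_ *: _).
    by apply/matrixP => j k; rewrite !mxE linearZ /= mulrA.
  + by move=> y c z z'; rewrite mulrDr -scalerAr tens_linearl.
  + by move=> y c z z'; rewrite tens_linearr.
move=> x b; rewrite /tens_actr tens_lift_sum; apply: eq_bigr => i _.
rewrite tens_liftE.
- rewrite [h i * b]split_mulC mul_split_idem rmorphM -scalerA; congr (_ *: _).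
  by apply/matrixP => j k; rewrite !mxE linearZ /= mulrCA.
- by move=> y c z z'; rewrite tens_linearl.
by move=> y c z z'; rewrite mulrDl -scalerAl tens_linearr.
Qed.

End SplitByCharacters.

(** * Evaluation at the points of the box *)

Section BoxEvaluation.
Variables (K : fieldType) (p : nat) (hp : p \in [pchar K]) (m r : nat).
Local Notation A := (distTr m hp r).
Local Notation box := {ffun 'I_m -> 'I_(p ^ r)}.

Definition distTr_ev (a : box) (x : A) : K := dist_ev (box_idx a) (val x).

Lemma distTr_ev_additive a : additive (distTr_ev a).
Proof. by move=> x y; rewrite /distTr_ev !raddfB. Qed.

HB.instance Definition _ a :=
  GRing.isZmodMorphism.Build A K (distTr_ev a) (distTr_ev_additive a).

Lemma distTr_ev_scalable a : scalable_for *%R (distTr_ev a).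
Proof. by move=> c x; rewrite /distTr_ev !linearZ. Qed.

HB.instance Definition _ a :=
  GRing.isScalable.Build K A K *%R (distTr_ev a) (distTr_ev_scalable a).

Lemma distTr_ev_monoid_morphism a : monoid_morphism (distTr_ev a).
Proof. by split=> [|x y]; rewrite /distTr_ev ?rmorph1 ?rmorphM. Qed.

HB.instance Definition _ a :=
  GRing.isMonoidMorphism.Build A K (distTr_ev a) (distTr_ev_monoid_morphism a).

(** Reducing the coordinates of [n] modulo [q] leaves the value at [n]
    unchanged, so agreement on the box forces agreement on all of [nat^m]. *)
Lemma distTr_ev_inj (x y : A) : (forall a, distTr_ev a x = distTr_ev a y) -> x = y.
Proof.
move=> exy; apply: val_inj; apply: dist_ev_inj => n.
have q0 : (0 < p ^ r)%N by rewrite expn_gt0 (prime_gt0 (pcharf_prime hp)).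
pose a : box := [ffun i => Ordinal (ltn_pmod (n i) q0)].
have E (z : A) : dist_ev n (val z) = distTr_ev a z.
  rewrite /distTr_ev /= !dist_evE [LHS]big_seq [RHS]big_seq.
  apply: eq_bigr => b bz; congr (_ * _).
  rewrite /mbin !natr_prod; apply: eq_bigr => i _.
  rewrite !ffunE /=; apply: bin_modq_pchar => //.
  by have /allP/(_ b bz)/forallP := valP z.
by rewrite !E.
Qed.

Lemma distTr_ev_X (n : box) i (a : 'I_(p ^ r)) :
  distTr_ev n (distTr_X hp i a) = (n i == a)%:R.
Proof.
rewrite linear_sum -[RHS](@sum_sign_bin_bin K (n i) a (p ^ r)) //=.
apply: eq_bigr => k _; rewrite linearZ /=; congr (_ * _).
rewrite /distTr_ev /= dist_ev_basis; congr (_%:R).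
rewrite /mbin (bigD1 i) //= !ffunE eqxx big1 ?muln1 // => j /negbTE ji.
by rewrite !ffunE ji bin0.
Qed.

Lemma distTr_ev_h (n a : box) : distTr_ev n (distTr_h hp a) = (n == a)%:R.
Proof.
rewrite rmorph_prod; case: eqP => [<-|/eqP na] /=.
  by rewrite big1 // => i _; rewrite distTr_ev_X eqxx.
have /existsP[i /negbTE hi] : [exists i, n i != a i].
  rewrite -negb_forall; apply: contraNN na => /forallP e.
  by apply/eqP/ffunP => i; apply/eqP.
by rewrite (bigD1 i) //= distTr_ev_X hi mul0r.
Qed.

End BoxEvaluation.

Theorem proposition1p4 (K : fieldType) (p : nat) (hp : p \in [pchar K])
    (m r : nat) (hm : (0 < m)%N) (hr : (0 < r)%N) :
  [/\ separable_algebra (distTr m hp r),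
      (forall a : {ffun 'I_m -> 'I_(p ^ r)},
         primitive_idempotent (distTr_h hp a)) &
      complete_orthogonal
        (fun a : {ffun 'I_m -> 'I_(p ^ r)} => distTr_h hp a)].
Proof.
pose chi (a : {ffun 'I_m -> 'I_(p ^ r)}) :
  {lrmorphism distTr m hp r -> K | *%R} := @distTr_ev K p hp m r a.
have inj : forall x y, (forall a, chi a x = chi a y) -> x = y.
  exact: distTr_ev_inj.
have dual : forall a b, chi a (distTr_h hp b) = (a == b)%:R.
  exact: distTr_ev_h.
split.
- exact: split_separable inj dual.
- exact: split_primitive inj dual.
exact: split_complete_orthogonal inj dual.
Qed.
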